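(* Let $m\ge 3$, $n\ge 2$ and $2\le l\le\lceil n/2\rceil$. For every positive integer $k$, $$\chi_{B_l^*(m,n)}(2k+1)=\Big[\sum_{i=0}^{m-2}(-1)^i(2k)^{(m-2)-i}\Big]\,\chi_{B_{l-1}^*(m,n-1)}(2k+1).$$
   Context: A signed graph $(G,\sigma)$ is a finite graph $G$ with a sign function $\sigma:E(G)\to\{+1,-1\}$; its signature is the set of negative edges. A signed coloring in $2k+1$ colors is a map $c:V(G)\to\{-k,\dots,k\}$; it is proper if $c(y)\neq\sigma(e)c(x)$ for every edge $e=xy$. The signed chromatic polynomial $\chi_{(G,\sigma)}(2k+1)$ is the number of proper signed colorings in $2k+1$ colors. For integers $m\ge 3$, $n\ge 1$, the Book graph $B(m,n)$ has vertex set $\{u,v\}\cup\{u_j^l:1\le l\le n,\,1\le j\le m-2\}$ and consists of the $n$ cycles $u\,u_1^l\cdots u_{m-2}^l\,v\,u$ sharing the edge $uv$. For $1\le l\le n$, $B_l^*(m,n)$ denotes $B(m,n)$ with signature $\{uv,uu_1^1,\dots,uu_1^{l-1}\}$. *)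

(* Defs.v *)
From HB Require Import structures.
From mathcomp Require Import all_boot all_order all_algebra.
Set Implicit Arguments.
Unset Strict Implicit.
Unset Printing Implicit Defensive.
Import Order.TTheory GRing.Theory Num.Theory.

Record graph := Graph {
  vertex :> finType;
  edges : {set {set vertex}};
  edges_card2 : forall e, e \in edges -> #|e| = 2
}.

(* The values of [sign] outside [edges] are irrelevant. *)
Record signed_graph := SignedGraph {
  underlying :> graph;
  sign : {set underlying} -> int;
  sign_pm1 : forall e, e \in edges underlying -> sign e = 1%R \/ sign e = (-1)%R
}.

Definition signature (S : signed_graph) : {set {set S}} :=
  [set e in edges S | sign e == (-1)%R].

Definition sign_of_signature (T : finType) (N : {set {set T}}) (e : {set T}) : int :=
  if e \in N then (-1)%R else 1%R.

Lemma sign_of_signature_pm1 (T : finType) (N : {set {set T}}) e :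
  sign_of_signature N e = 1%R \/ sign_of_signature N e = (-1)%R.
Proof. by rewrite /sign_of_signature; case: ifP; [right | left]. Qed.

Definition signed_by (G : graph) (N : {set {set G}}) : signed_graph :=
  @SignedGraph G (sign_of_signature N) (fun e _ => sign_of_signature_pm1 N e).

Lemma signature_signed_by (G : graph) (N : {set {set G}}) :
  N \subset edges G -> signature (signed_by N) = N.
Proof.
move=> /subsetP sNE; apply/setP=> e; rewrite inE /= /sign_of_signature.
by case: ifP => [/sNE -> | _]; rewrite ?andbF.
Qed.

(* The colors -k, ..., k are indexed by 'I_(2k+1): index i stands for i - k. *)
Definition color (k : nat) (i : 'I_(2 * k + 1)) : int := (i%:Z - k%:Z)%R.

Lemma color_inj k : injective (@color k).
Proof. by move=> i j /addIr [] /val_inj. Qed.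

Lemma colorP k (z : int) :
  (exists i : 'I_(2 * k + 1), color i = z) <-> (- k%:Z <= z <= k%:Z)%R.
Proof.
split=> [[i <-]|/andP[kz zk]].
  rewrite /color lerBrDr addNr lerBlDr -PoszD addnn !lez_nat /=.
  by case: i => i /=; rewrite addn1 mul2n ltnS.
have z0 : (0 <= z + k%:Z)%R by rewrite -lerBlDr sub0r.
have zE : (`|(z + k%:Z)%R|%N%:Z = z + k%:Z)%R by rewrite gez0_abs.
have lt : `|(z + k%:Z)%R|%N < 2 * k + 1.
  by rewrite addn1 ltnS -lez_nat zE mul2n -addnn PoszD lerD2r.
by exists (Ordinal lt); rewrite /color /= zE addrK.
Qed.

Definition signed_coloring (S : signed_graph) (k : nat) :=
  {ffun S -> 'I_(2 * k + 1)}.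

Definition proper_coloring (S : signed_graph) (k : nat) (c : signed_coloring S k) : bool :=
  [forall x, forall y, ([set x; y] \in edges S) ==>
     (color (c y) != sign [set x; y] * color (c x))%R].

(* The value at 2k+1 of the signed chromatic polynomial of S. *)
Definition signed_chromatic (S : signed_graph) (k : nat) : nat :=
  #|[set c : signed_coloring S k | proper_coloring c]|.

(* [inr (p, j)] is the vertex u_{j+1}^{p+1}. *)
Definition book_vertex (m n : nat) : finType := (bool + 'I_n * 'I_(m - 2))%type.

Definition book_u m n : book_vertex m n := inl true.
Definition book_v m n : book_vertex m n := inl false.

(* Along page p, the path u, u_1, ..., u_{m-2}, v occupies positions
   0, 1, ..., m-2, m-1. *)
Definition book_pos m n (p : 'I_n) (j : nat) : book_vertex m n :=
  if j is i.+1 then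
    if insub i is Some q then inr (p, q) else book_v m n
  else book_u m n.

Definition book_edges m n : {set {set book_vertex m n}} :=
  [set book_u m n; book_v m n]
    |: [set [set book_pos m p j; book_pos m p j.+1] | p : 'I_n, j : 'I_(m - 1)].

Lemma book_edges_card2 m n e : e \in book_edges m n -> #|e| = 2.
Proof.
rewrite !inE => /orP[/eqP-> | /imset2P[p j _ _ ->]]; first by rewrite cards2.
rewrite cards2; case: j => [[|j] ltj] /=.
  by case: insubP.
have lt : j < m - 2 by rewrite ltn_subRL -[2]/(1 + 1) -addnA -ltn_subRL.
rewrite insubT /=; case: insubP => //= q _ qE.
suff -> : inr (p, Sub j lt) != inr (p, q) :> book_vertex m n by [].
by apply/eqP=> -[jq]; move: qE; rewrite -jq /= => /n_Sn.
Qed.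

Definition book m n : graph := Graph (@book_edges_card2 m n).

(* uv together with the edges u u_1^1, ..., u u_1^{l-1}. *)
Definition book_star_signature m n l : {set {set book m n}} :=
  [set book_u m n; book_v m n]
    |: [set [set book_u m n; book_pos m p 1] | p : 'I_n & p < l.-1].

Definition book_star m n l : signed_graph :=
  signed_by (book_star_signature m n l).

Lemma signature_book_star m n l :
  2 < m -> signature (book_star m n l) = book_star_signature m n l.
Proof.
move=> m_gt2; apply/signature_signed_by/subsetP=> e.
rewrite !inE => /orP[-> // | /imsetP[p _ ->]]; apply/orP; right.
have lt0 : 0 < m - 1 by rewrite subn_gt0 ltnW.
by apply/imset2P; exists p (Ordinal lt0).
Qed.

(* Main.v *)
Require Import Defs.
From HB Require Import structures.
From mathcomp Require Import all_boot all_order all_algebra.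
From mathcomp Require Import zify ring.
Import Order.TTheory GRing.Theory Num.Theory.

(** Fix the colors [a] of [u] and [b] of [v].  The pages are then colored
    independently, and the colorings of a page are the walks of length [m - 1]
    in the complete graph on the colors, from [a] to [b] if the edges of
    its path are positive, and from [-a] to [b] if the first one is negative.  As [uv] is
    negative, [b <> -a], so a negative page always contributes the number of
    walks between two distinct points, which is the alternating sum and does
    not depend on [a] and [b].  Hence one negative page factors out. *)

Set Implicit Arguments.
Unset Strict Implicit.
Unset Printing Implicit Defensive.

Section Walks.

Variable T : finType.

Definition is_walk (a b : T) (t : seq T) : bool :=
  path (fun x y => x != y) a (rcons t b).

(* Walks are counted by their number [s] of internal points. *)
Definition walks (s : nat) (a b : T) : nat :=
  \sum_(t : s.-tuple T) is_walk a b t.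

Lemma walks0 a b : walks 0 a b = (a != b).
Proof.
rewrite /walks (big_pred1 [tuple]); last by move=> t; rewrite (tuple0 t) /= eqxx.
by rewrite /is_walk /= andbT.
Qed.

Lemma walksS s a b : walks s.+1 a b = \sum_(x | x != a) walks s x b.
Proof.
rewrite /walks (reindex (fun p : T * s.-tuple T => [tuple of p.1 :: p.2])) /=; last first.
  exists (fun t : s.+1.-tuple T => (thead t, [tuple of behead t])).
    by move=> [x t] _; congr pair; apply: val_inj.
  by move=> t _; rewrite [RHS]tuple_eta; apply: val_inj.
rewrite -(pair_bigA _ (fun x (t : s.-tuple T) => nat_of_bool (is_walk a b (x :: t)))) /=.
rewrite [RHS]big_mkcond; apply: eq_bigr => x _.
rewrite /is_walk /= eq_sym; case: (x != a) => //=.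
by rewrite big1.
Qed.

(** For [x] other than -1 this is (x^(s+1) - (-1)^(s+1)) / (x + 1). *)
Definition alt_sum (x : int) (s : nat) : int :=
  (\sum_(0 <= i < s.+1) (-1) ^+ i * x ^+ (s - i)%N)%R.

Lemma alt_sumS x s : (alt_sum x s.+1 = x * alt_sum x s + (-1) ^+ s.+1)%R.
Proof.
rewrite /alt_sum big_nat_recr //= subnn expr0 mulr1; congr +%R.
rewrite big_distrr !big_mkord; apply: eq_bigr => i _ /=.
by rewrite subSn ?exprS 1?mulrCA // -ltnS.
Qed.

(** Induction on [s]: the first internal point is anything but [a], so the count is the total over
    all starting points minus the count from [a]; this subtraction flips the sign of the term for
    [a == b]. *)
Lemma walksE q s a b : #|T| = q.+1 ->
  ((walks s a b)%:Z = alt_sum q%:Z s - (-1) ^+ s * (a == b)%:Z)%R.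
Proof.
move=> Tq; elim: s a => [|s IHs] a.
  rewrite walks0 /alt_sum big_nat1 !expr0 !mul1r.
  by case: (a == b).
have sumE : (\sum_x (walks s x b)%:Z = q.+1%:Z * alt_sum q%:Z s - (-1) ^+ s)%R.
  under eq_bigr do rewrite IHs.
  rewrite big_split sumr_const Tq /= -mulr_natl natz; congr +%R.
  rewrite (bigD1 b) //= eqxx mulr1 big1 ?addr0 // => x /negPf ->.
  by rewrite mulr0 oppr0.
have -> : ((walks s.+1 a b)%:Z = \sum_x (walks s x b)%:Z - (walks s a b)%:Z)%R.
  rewrite (bigD1 a) //= [X in (X - _)%R]addrC addrK walksS -natz natr_sum.
  by under eq_bigr do rewrite natz.
by rewrite sumE IHs alt_sumS exprS -addn1 PoszD; ring.
Qed.

Lemma walks_neq q s a b : #|T| = q.+1 -> a != b ->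
  ((walks s a b)%:Z = alt_sum q%:Z s)%R.
Proof. by move=> Tq /negPf neq; rewrite (walksE _ _ _ Tq) neq mulr0 subr0. Qed.

End Walks.

Lemma set2_eq (T : finType) (x y x' y' : T) : [set x; y] = [set x'; y'] ->
  (x = x' /\ y = y') \/ (x = y' /\ y = x').
Proof.
move=> E.
have xin : x \in [set x'; y'] by rewrite -E set21.
have yin : y \in [set x'; y'] by rewrite -E set22.
have x'in : x' \in [set x; y] by rewrite E set21.
have y'in : y' \in [set x; y] by rewrite E set22.
move: xin yin x'in y'in; rewrite !inE.
by do 4![case/orP=> /eqP ?]; subst; auto.
Qed.

(** Index [i] stands for i - k and [rev_ord] sends it to 2k - i, so reversal acts as negation. *)
Lemma color_rev k (i : 'I_(2 * k + 1)) : (color (rev_ord i) = - color i)%R.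
Proof. by rewrite /color /=; have := ltn_ord i; lia. Qed.

Section BookColorings.

Variables m n l k : nat.
Hypothesis m_gt2 : 2 < m.

Notation C := 'I_(2 * k + 1).
Notation B := (book_star m n l).
Implicit Type c : signed_coloring B k.

(** Only the first edge of a page path can be negative, and negating the color of [u] absorbs its
    sign. Pages are numbered from 0, so the negative ones are those below l - 1. *)
Definition page_start (p : nat) (a : C) : C := if p < l.-1 then rev_ord a else a.

Definition page c (p : 'I_n) : (m - 2).-tuple C := [tuple c (inr (p, j)) | j < m - 2].

Lemma coloring_pos c p j x0 : j < m ->
  c (book_pos m p j) = nth x0 (c (book_u m n) :: rcons (page c p) (c (book_v m n))) j.
Proof.
have pageE q : c (inr (p, q)) = nth x0 (page c p) q.
  by rewrite -tnth_nth tnth_mktuple.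
move: (page c p) pageE => t tE.
case: j => [//|j] ltj /=; rewrite nth_rcons size_tuple.
case: insubP => [q _ <-|]; first by rewrite tE (valP q).
(* Past the internal vertices only position m - 1 is left, which is [v]. *)
rewrite -leqNgt => le; have -> : j = (m - 2)%N by lia.
by rewrite ltnn eqxx.
Qed.

Lemma edge_proper (e : {set B}) (a b : C) :
  (color b != @sign B e * color a)%R =
  (b != if e \in book_star_signature m n l then rev_ord a else a).
Proof.
rewrite /= /sign_of_signature; case: ifP => _.
  by rewrite mulN1r -color_rev (inj_eq (@color_inj k)).
by rewrite mul1r (inj_eq (@color_inj k)).
Qed.

(** Negation is an involution, so the direction in which an edge is read is immaterial. *)
Lemma edge_proper_sym (e : {set B}) (a b : C) :
  (color b != @sign B e * color a)%R = (color a != @sign B e * color b)%R.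
Proof.
rewrite !edge_proper; case: ifP => _; last by rewrite eq_sym.
by rewrite -(inj_eq rev_ord_inj) rev_ordK eq_sym.
Qed.

(** As [m > 2], the first step of a page does not reach [v], so its edge is not uv. *)
Lemma book_pos1 (p : 'I_n) : exists q, book_pos m p 1 = inr (p, q).
Proof. by rewrite /=; case: insubP => [q _ _|]; [exists q | lia]. Qed.

Lemma page_edge_signature (p : 'I_n) j : j < m - 1 ->
  ([set book_pos m p j; book_pos m p j.+1] \in book_star_signature m n l)
  = (j == 0) && (p < l.-1).
Proof.
move=> ltj; apply/idP/idP => [|/andP[/eqP -> ltp]]; last first.
  by rewrite !inE; apply/orP; right; apply/imsetP; exists p; rewrite ?inE.
case: j ltj => [_|j ltj].
  rewrite !inE => /orP[/eqP/set2_eq|/imsetP[p']].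
    by have [q ->] := book_pos1 p; case=> [[]|[]].
  rewrite inE => ltp' /set2_eq.
  have [q ->] := book_pos1 p; have [q' ->] := book_pos1 p'.
  by case=> [[_ [->]]|[]].
(* Later edges of the path avoid [u], which lies on every negative edge. *)
have uin e : e \in book_star_signature m n l -> book_u m n \in e.
  by rewrite !inE => /orP[/eqP->|/imsetP[p' _ ->]]; rewrite !inE eqxx.
by move/uin; rewrite !inE /=; do 2![case: insubP => [? _ _|_]].
Qed.

Lemma properE c : proper_coloring c =
  (c (book_v m n) != rev_ord (c (book_u m n))) &&
  [forall p : 'I_n,
    is_walk (page_start p (c (book_u m n))) (c (book_v m n)) (page c p)].
Proof.
set u := book_u m n; set v := book_v m n.
have pageP (p : 'I_n) :
    reflect (forall j, j < m - 1 ->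
      (color (c (book_pos m p j.+1))
         != @sign B [set book_pos m p j; book_pos m p j.+1]
              * color (c (book_pos m p j)))%R)
    (is_walk (page_start p (c u)) (c v) (page c p)).
  (* The walk differs from the colors along the path only in its start, which matters at [j = 0].
     All indices are in range, so the default [c u] is never read. *)
  have stepE j : j < m - 1 ->
    (color (c (book_pos m p j.+1))
         != @sign B [set book_pos m p j; book_pos m p j.+1]
              * color (c (book_pos m p j)))%R =
    (nth (c u) (page_start p (c u) :: rcons (page c p) (c v)) j
       != nth (c u) (rcons (page c p) (c v)) j).
    move=> ltj; rewrite edge_proper page_edge_signature // eq_sym.
    rewrite !(coloring_pos _ _ (c u)); try lia.
    by case: j ltj => [|j] ltj.
  have szE : size (rcons (page c p) (c v)) = (m - 1)%N.
    by rewrite size_rcons size_tuple; lia.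
  apply: (iffP (pathP (c u))) => H j ltj.
    by rewrite stepE //; apply: H; rewrite szE.
  by rewrite -stepE -?szE //; apply: H; rewrite -szE.
have uvE : (color (c v) != @sign B [set u; v] * color (c u))%R
           = (c v != rev_ord (c u)).
  by rewrite edge_proper !inE eqxx.
apply/idP/andP => [proper_c|[uv_ok /forallP pages_ok]].
  have edge_ok x y : [set x; y] \in edges B ->
      (color (c y) != @sign B [set x; y] * color (c x))%R.
    by move: proper_c => /forallP/(_ x)/forallP/(_ y)/implyP.
  split; first by rewrite -uvE; apply: edge_ok; rewrite !inE eqxx.
  apply/forallP => p; apply/pageP => j ltj; apply: edge_ok.
  by rewrite !inE; apply/orP; right; apply/imset2P; exists p (Ordinal ltj).
apply/forallP => x; apply/forallP => y; apply/implyP.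
(* Properness quantifies over both orders of the ends, while [book_edges] gives each edge in one
   order. *)
have wlog_edge x' y' : (color (c y') != @sign B [set x'; y'] * color (c x'))%R ->
    [set x; y] = [set x'; y'] ->
    (color (c y) != @sign B [set x; y] * color (c x))%R.
  by move=> ok E; rewrite E; case: (set2_eq E) => [[-> ->]|[-> ->]] //;
     rewrite edge_proper_sym.
rewrite !inE => /orP[/eqP|/imset2P[p [j ltj] _ _]]; apply: wlog_edge.
  by rewrite uvE.
exact: (pageP p).
Qed.

Lemma book_chromaticE : signed_chromatic B k =
  \sum_(ab : C * C | ab.2 != rev_ord ab.1)
    \prod_(p < n) walks (m - 2) (page_start p ab.1) ab.2.
Proof.
(* Colorings correspond bijectively to the two end colors together with a free choice of tuple for
   each page. *)
pose glue (z : C * C * {ffun 'I_n -> (m - 2).-tuple C}) : signed_coloring B k :=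
  [ffun x : book_vertex m n => match x with
    | inl h => if h then z.1.1 else z.1.2
    | inr pj => tnth (z.2 pj.1) pj.2 end].
have page_glue z p : page (glue z) p = z.2 p.
  by apply: eq_from_tnth => j; rewrite tnth_mktuple ffunE.
rewrite /signed_chromatic -sum1dep_card (reindex glue) /=; last first.
  exists (fun c => ((c (book_u m n), c (book_v m n)), [ffun p => page c p])).
    move=> [[a b] f] _; congr pair; first by rewrite !ffunE.
    by apply/ffunP => p; rewrite ffunE page_glue.
  move=> c _; apply/ffunP => x; rewrite ffunE.
  by case: x => [[]|[p j]] //=; rewrite ffunE tnth_mktuple.
rewrite big_mkcond [RHS]big_mkcond /=.
rewrite -(pair_bigA _ (fun ab f => if proper_coloring (glue (ab, f)) then 1 else 0)) /=.
apply: eq_bigr => -[a b] _ /=.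
have glueE f : proper_coloring (glue ((a, b), f)) =
    (b != rev_ord a) && [forall p : 'I_n, is_walk (page_start p a) b (f p)].
  rewrite properE !ffunE; congr andb.
  by apply: eq_forallb => p; rewrite page_glue.
under eq_bigr do rewrite glueE.
case: (b != rev_ord a) => /=; last by rewrite big1.
(* By distributivity the product of page counts is a sum over page families of products of
   indicators. *)
rewrite /walks bigA_distr_bigA /=; apply: eq_bigr => f _.
case: forallP => [walk_f|/forallP]; first by rewrite big1 // => p _; rewrite walk_f.
by rewrite negb_forall => /existsP[p /negPf not_walk]; rewrite (bigD1 p) //= not_walk.
Qed.

End BookColorings.

Theorem theorem6p10 (m n l k : nat) (hm : (3 <= m)%N) (hn : (2 <= n)%N)
    (hl : (2 <= l <= uphalf n)%N) (hk : (0 < k)%N) :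
  ((signed_chromatic (book_star m n l) k)%:Z =
   (\sum_(0 <= i < (m - 2).+1) (-1) ^+ i * (2 * k%:Z) ^+ (m - 2 - i)%N) *
   (signed_chromatic (book_star m (n - 1)%N (l - 1)%N) k)%:Z)%R.
Proof.
case/andP: hl => + _; case: l => [|[|l]] // _.
case: n hn => [//|n] _.
rewrite !book_chromaticE // !subn1 /=.
rewrite -[X in X = _]natz -[X in _ = (_ * X)%R]natz !natr_sum big_distrr /=.
(* Page 0 is negative because the original l is at least 2. Once it is split off, page p + 1 takes
   the role of page p, negative exactly when p < l - 2: this is the product for n - 1 and l - 1. *)
apply: eq_bigr => -[a b] /= neq_ba; rewrite big_ord_recl natrM natz; congr *%R.
have cardC : #|'I_(2 * k + 1)| = (2 * k).+1 by rewrite card_ord addn1.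
(* The walk of page 0 runs from -a to b, distinct because uv is properly colored. *)
rewrite (walks_neq _ cardC); last by rewrite eq_sym.
by rewrite PoszM.
Qed.
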